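(* Let $\ell$ be a positive integer, and let $G$ be a connected graph of order $n$ such that $n\equiv 2\pmod{\ell}$. If $$\delta(G)>\frac{(\ell-1)n}{\ell},$$ then the greedy leaf-adjoining algorithm (described in the context), applied to $G$ and $\ell$, returns an $\ell$-congruent spanning tree of $G$, whatever choices are made during its execution.
   Context: Graphs are finite and simple (undirected, no loops or multiple edges). The order of a graph is its number of vertices, $\delta(G)$ is the minimum vertex degree of $G$, and $d_T(v)$ is the degree of $v$ in $T$. For a positive integer $\ell$, an $\ell$-congruent tree is a nontrivial tree $T$ (at least two vertices) such that the degrees of all vertices of $T$ are congruent modulo $\ell$; equivalently, $d_T(v)\equiv 1\pmod{\ell}$ for every $v\in V(T)$. An $\ell$-congruent spanning tree of $G$ is a spanning tree of $G$ that is an $\ell$-congruent tree. Greedy leaf-adjoining algorithm. Input: a nontrivial connected graph $G$ (at least two vertices) and a positive integer $\ell$. Step 1: choose an arbitrary edge of $G$, and let $T$ be the tree consisting of this edge and its two endvertices. Step 2: while some vertex $v\in V(T)$ has at least $\ell$ neighbors (in $G$) outside $V(T)$, choose such a vertex $v$, choose any $\ell$ of its neighbors outside $V(T)$, and add these $\ell$ vertices together with the $\ell$ edges joining them to $v$ to $T$. Step 3: when no vertex of $T$ has at least $\ell$ neighbors outside $V(T)$, return $T$. (All choices are arbitrary.) *)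

(* Defs.v *)
From mathcomp Require Import all_boot.

Set Implicit Arguments.
Unset Strict Implicit.
Unset Printing Implicit Defensive.

(* A finite simple graph is a symmetric irreflexive relation on a finType. *)

Section Graphs.
Variable V : finType.
Implicit Types (e : rel V) (v : V).

Definition neighbors e v : {set V} := [set u | e v u].

Definition degree e v : nat := #|neighbors e v|.

(* The default value #|V| is never attained by a degree in a simple graph, so
   it is irrelevant as soon as V is nonempty. *)
Definition min_degree e : nat := \big[minn/#|V|]_(v : V) degree e v.

Definition connected_graph e : Prop :=
  0 < #|V| /\ forall x y : V, connect e x y.

(* A candidate subgraph: a set of vertices, and a set of edges, the edge xy
   being represented by the unordered pair [set x; y]. *)
Record subgraph := Subgraph {
  verts : {set V};
  edges : {set {set V}}
}.

Implicit Type T : subgraph.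

Definition adj T : rel V := fun x y => [set x; y] \in edges T.

Definition subgraph_of e T : Prop :=
  forall f, f \in edges T ->
    exists x y, [/\ x \in verts T, y \in verts T, e x y & f = [set x; y]].

Definition connected_subgraph T : Prop :=
  0 < #|verts T| /\ {in verts T &, forall x y, connect (adj T) x y}.

(* In a simple graph, a cycle has at least three vertices; [ucycle] also
   accepts the empty sequence and back-and-forth walks along one edge. *)
Definition acyclic T : Prop :=
  forall c : seq V, ucycle (adj T) c -> size c < 3.

Definition tree T : Prop := connected_subgraph T /\ acyclic T.

Definition congruent_tree (l : nat) T : Prop :=
  [/\ tree T, 1 < #|verts T| &
      {in verts T &, forall x y,
         degree (adj T) x = degree (adj T) y %[mod l]}].

Definition congruent_spanning_tree e (l : nat) T : Prop :=
  [/\ subgraph_of e T, verts T = [set: V] & congruent_tree l T].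

Definition edge_subgraph (x y : V) : subgraph :=
  Subgraph [set x; y] [set [set x; y]].

Definition adjoin T v (S : {set V}) : subgraph :=
  Subgraph (verts T :|: S) (edges T :|: [set [set v; u] | u in S]).

Definition outer_neighbors e T v : {set V} := neighbors e v :\: verts T.

Definition greedy_init e T : Prop :=
  exists x y, e x y /\ T = edge_subgraph x y.

Definition greedy_step e (l : nat) T T' : Prop :=
  exists (v : V) (S : {set V}),
    [/\ v \in verts T, S \subset outer_neighbors e T v,
      #|S| = l & T' = adjoin T v S].

Definition greedy_halted e (l : nat) T : Prop :=
  ~ exists2 v, v \in verts T & l <= #|outer_neighbors e T v|.

Inductive greedy_reachable e (l : nat) : subgraph -> Prop :=
| Greedy_init T : greedy_init e T -> greedy_reachable e l T
| Greedy_step T T' : greedy_reachable e l T -> greedy_step e l T T' ->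
    greedy_reachable e l T'.

(* T is the output of some execution. *)
Definition greedy_returns e (l : nat) T : Prop :=
  greedy_reachable e l T /\ greedy_halted e l T.

(* No execution of the loop from T goes on forever. *)
Definition greedy_terminates_from e (l : nat) T : Prop :=
  Acc (fun T2 T1 => greedy_step e l T1 T2) T.

(* Total correctness under all choices: step 1 can be performed, every
   execution is finite, and every possible output satisfies P.  A state that
   is not halted always admits a step, so executions never get stuck. *)
Definition greedy_always_returns e (l : nat) (P : subgraph -> Prop) : Prop :=
  [/\ exists T, greedy_init e T,
      forall T, greedy_init e T -> greedy_terminates_from e l T &
      forall T, greedy_returns e l T -> P T].

End Graphs.

(* Main.v *)
Require Import Defs.
From mathcomp Require Import all_boot all_order all_algebra.
From mathcomp Require Import zify.

Set Implicit Arguments.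
Unset Strict Implicit.
Unset Printing Implicit Defensive.

Import Order.TTheory GRing.Theory Num.Theory.

(** Adjoining [l] new leaves at a vertex of a tree gives a tree, raises the
    order and one degree by [l], and creates only vertices of degree 1.  So the
    order stays congruent to 2 and all degrees stay congruent to 1 modulo [l]
    ([reachable_invariant]), and the order increases strictly, which forces
    termination.  What needs the degree hypothesis is that a halted tree spans.

    Suppose that the algorithm halts with the vertex set [A], and let [m > 0] be
    the number of vertices outside.  As [n] and [#|A|] are both congruent to 2,
    [l] divides [m], so [l <= m].  If [l = 1], no edge leaves [A], against
    connectedness.  If [l >= 2], write [d] for the minimum degree and
    [r = n - d >= 1]; the hypothesis says that [(l - 1) r < d].
    Every vertex of [A] has at most [l - 1] neighbors outside, and every outer
    vertex has at least [d - (m - 1)] neighbors in [A]; counting the edges that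
    leave [A] from both sides ([card_edges_between]) gives
      [m (d + 1 - m) <= (l - 1) (n - m) = (l - 1) d + (l - 1) r - (l - 1) m].
    Replacing [(l - 1) r] by the larger [d] yields [(m - l) d < (m - l) m],
    that is, [d < m].  But a vertex of [A] has degree at most
    [(n - m - 1) + (l - 1)], so [m <= r + l - 2].  Hence
    [(l - 1) r < d < m <= r + l - 2], which fails for [r >= 1]
    ([halted_arith]). *)

(** * Adjoining leaves to a tree *)

Lemma eq_set2 (V : finType) (x y a b : V) :
  ([set x; y] == [set a; b]) =
  ((x == a) && (y == b)) || ((x == b) && (y == a)).
Proof.
apply/eqP/idP; last first.
  by case/orP=> /andP[/eqP-> /eqP->] //; rewrite setUC.
(* Testing each of the four points for membership leaves a Boolean case check. *)
move/setP=> eq_xyab.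
have := eq_xyab x; have := eq_xyab y; have := eq_xyab a; have := eq_xyab b.
rewrite !inE !eqxx ?orbT /= (eq_sym b x) (eq_sym b y) (eq_sym a x) (eq_sym a y).
by case: (x == a); case: (y == b); case: (x == b); case: (y == a).
Qed.

Section Adjoining.
Variable V : finType.
Implicit Types (e : rel V) (T : subgraph V) (S : {set V}) (v x y : V).

Lemma adj_sym T : symmetric (adj T).
Proof. by move=> x y; rewrite /adj setUC. Qed.

Lemma subgraph_adj e T x y : symmetric e -> subgraph_of e T -> adj T x y ->
  [/\ x \in verts T, y \in verts T & e x y].
Proof.
move=> e_sym sub_eT /sub_eT[a [b [aT bT eab /eqP]]]; rewrite eq_set2.
by case/orP=> /andP[/eqP-> /eqP->]; rewrite // e_sym.
Qed.

Lemma adj_adjoin T v S x y : adj (adjoin T v S) x y =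
  [|| adj T x y, (x == v) && (y \in S) | (y == v) && (x \in S)].
Proof.
rewrite /adj /= inE; congr (_ || _).
apply/imsetP/orP=> [[u uS /eqP]|[/andP[/eqP-> yS]|/andP[/eqP-> xS]]].
- by rewrite eq_set2 => /orP[]/andP[/eqP-> /eqP->];
    rewrite eqxx uS; [left | right].
- by exists y.
- by exists x; rewrite // setUC.
Qed.

Lemma subgraph_of_adjoin e T v S :
    v \in verts T -> S \subset outer_neighbors e T v ->
  subgraph_of e T -> subgraph_of e (adjoin T v S).
Proof.
move=> vT /subsetP Sout sub_eT f; rewrite inE => /orP[/sub_eT|/imsetP[u uS ->]].
  by case=> x [y [xT yT exy ->]]; exists x, y; rewrite !inE xT yT.
have := Sout _ uS; rewrite !inE => /andP[_ evu].
by exists v, u; rewrite !inE vT uS orbT.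
Qed.

Lemma connected_adjoin T v S : v \in verts T ->
  connected_subgraph T -> connected_subgraph (adjoin T v S).
Proof.
move=> vT [_ connT]; split; first by apply/card_gt0P; exists v; rewrite inE vT.
have to_v w : w \in verts (adjoin T v S) -> connect (adj (adjoin T v S)) w v.
  rewrite inE => /orP[wT|wS]; last first.
    by apply: connect1; rewrite adj_adjoin eqxx wS !orbT.
  apply: connect_sub (connT _ _ wT vT) => x y xy.
  by apply: connect1; rewrite adj_adjoin xy.
move=> x y /to_v xv /to_v yv; apply: connect_trans xv _.
by rewrite (sym_connect_sym (@adj_sym _)).
Qed.

(** A new vertex has [v] as its only neighbor, so it lies on no cycle: its two
    neighbors along the cycle would both be [v]. *)
Lemma acyclic_adjoin e T v S :
    symmetric e -> subgraph_of e T ->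
    v \in verts T -> S \subset outer_neighbors e T v ->
  acyclic T -> acyclic (adjoin T v S).
Proof.
move=> e_sym sub_eT vT /subsetP Sout acT c /andP[cyc_c uniq_c].
have StT u : u \in S -> u \notin verts T.
  by move=> /Sout; rewrite !inE => /andP[].
have leaf u w : u \in S -> adj (adjoin T v S) u w -> w = v.
  move=> uS; rewrite adj_adjoin => /or3P[/(subgraph_adj e_sym sub_eT)[uT]| |].
  - by rewrite (negPf (StT u uS)) in uT.
  - by case/andP=> /eqP eq_uv; rewrite eq_uv in uS; rewrite (negPf (StT v uS)) in vT.
  - by case/andP=> /eqP.
have [/hasP[u uc uS]|/hasPn cS] := boolP (has (mem S) c).
  have [i p def_c] := rot_to uc.
  rewrite -(size_rot i); rewrite -(rot_cycle i) in cyc_c.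
  rewrite -(rot_uniq i) in uniq_c; move: cyc_c uniq_c; rewrite def_c.
  (* The cycle reads [u, a, b, ...]: here [a] becomes [v], and so does the last
     vertex, which is another entry of the cycle. *)
  case: p {def_c} => [|a [|b p]] //= /andP[/(leaf _ _ uS)-> /andP[_]].
  rewrite rcons_path adj_sym => /andP[_ /(leaf _ _ uS) last_v].
  by rewrite inE -{2}last_v mem_last !andbF.
apply: acT; rewrite /ucycle uniq_c andbT.
apply: (sub_in_cycle (P := [predC S])) cyc_c; last exact/allP.
move=> x y; rewrite !inE adj_adjoin => xS yS.
by rewrite (negPf xS) (negPf yS) !andbF !orbF.
Qed.

Lemma tree_adjoin e T v S :
    symmetric e -> subgraph_of e T ->
    v \in verts T -> S \subset outer_neighbors e T v ->
  tree T -> tree (adjoin T v S).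
Proof.
move=> e_sym sub_eT vT Sout [connT acT].
by split; [apply: connected_adjoin | apply: acyclic_adjoin acT].
Qed.

Lemma card_verts_adjoin e T v S : S \subset outer_neighbors e T v ->
  #|verts (adjoin T v S)| = #|verts T| + #|S|.
Proof.
move=> Sout; rewrite /= cardsU (_ : _ :&: _ = set0) ?cards0 ?subn0 //.
apply/setP=> u; rewrite !inE; apply/negP=> /andP[uT /(subsetP Sout)].
by rewrite !inE uT.
Qed.

Lemma degree_adjoin e T v S x :
    symmetric e -> subgraph_of e T ->
    v \in verts T -> S \subset outer_neighbors e T v ->
  degree (adj (adjoin T v S)) x =
  if x \in S then 1 else degree (adj T) x + (x == v) * #|S|.
Proof.
move=> e_sym sub_eT vT /subsetP Sout.
have StT u : u \in S -> u \notin verts T.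
  by move=> /Sout; rewrite !inE => /andP[].
have vS : v \notin S by apply/negP=> /StT; rewrite vT.
have out u w : u \in S -> adj T u w = false.
  move=> uS; apply/negP=> /(subgraph_adj e_sym sub_eT)[uT].
  by rewrite (negPf (StT u uS)) in uT.
rewrite /degree; case: ifP => xS.
  rewrite (_ : neighbors _ x = [set v]) ?cards1 //.
  apply/setP=> y; rewrite !inE adj_adjoin out //= xS andbT.
  by case: (x =P v) => [xv|//]; rewrite -xv xS in vS.
case: (x =P v) => [->|/eqP xv] /=; last first.
  rewrite addn0; congr #|pred_of_set _|; apply/setP=> y.
  by rewrite !inE adj_adjoin (negPf xv) xS andbF !orbF.
rewrite mul1n (_ : neighbors _ v = neighbors (adj T) v :|: S); last first.
  by apply/setP=> y; rewrite !inE adj_adjoin eqxx (negPf vS) andbF orbF.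
rewrite cardsU (_ : _ :&: _ = set0) ?cards0 ?subn0 //.
apply/setP=> u; rewrite !inE adj_sym; apply/negP=> /andP[vu uS].
by rewrite out in vu.
Qed.

(** * The loop invariant *)

Definition vertex_subgraph x : subgraph V := Subgraph [set x] set0.

(** The initial edge is a leaf adjoined to a single vertex, so the facts about
    adjoining also cover the first step of the algorithm. *)
Lemma edge_subgraphE x y :
  edge_subgraph x y = adjoin (vertex_subgraph x) x [set y].
Proof. by rewrite /adjoin /= set0U imset_set1. Qed.

Lemma tree_vertex x : tree (vertex_subgraph x).
Proof.
split; first split; first by rewrite cards1.
  by move=> y z /set1P-> /set1P->; apply: connect0.
by case=> [|y [|z c]] //= /andP[/andP[]]; rewrite /adj inE.
Qed.

Lemma reachable_invariant e l T :
    symmetric e -> irreflexive e -> greedy_reachable e l T ->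
  [/\ subgraph_of e T, tree T, 1 < #|verts T|, #|verts T| = 2 %[mod l]
    & {in verts T, forall x, degree (adj T) x = 1 %[mod l]}].
Proof.
move=> e_sym e_irr; elim=> {T} [T [x [y [exy ->]]]|T T' _ IH].
  have sub_x : subgraph_of e (vertex_subgraph x) by move=> f; rewrite inE.
  have xx : x \in verts (vertex_subgraph x) by apply: set11.
  have yout : [set y] \subset outer_neighbors e (vertex_subgraph x) x.
    rewrite sub1set !inE exy andbT; apply: contraTneq exy => ->.
    by rewrite e_irr.
  rewrite edge_subgraphE; split.
  - exact: subgraph_of_adjoin xx yout sub_x.
  - exact: tree_adjoin e_sym sub_x xx yout (tree_vertex x).
  - by rewrite (card_verts_adjoin yout) !cards1.
  - by rewrite (card_verts_adjoin yout) !cards1.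
  move=> z; rewrite (degree_adjoin _ e_sym sub_x) // !inE.
  case: (z == y) => //; rewrite orbF => ->; rewrite cards1 /degree.
  rewrite (_ : neighbors _ z = set0) ?cards0 //.
  by apply/setP=> w; rewrite !inE /adj inE.
case: IH => sub_eT treeT T_gt1 cardT degT [v [S [vT Sout cardS ->]]]; split.
- exact: subgraph_of_adjoin vT Sout sub_eT.
- exact: tree_adjoin e_sym sub_eT vT Sout treeT.
- by rewrite (card_verts_adjoin Sout) ltn_addr.
- by rewrite (card_verts_adjoin Sout) cardS modnDr.
move=> x; rewrite (degree_adjoin _ e_sym sub_eT) // inE cardS.
case: (x \in S) => //; rewrite orbF => xT.
by rewrite addnC modnMDl; apply: degT.
Qed.

Lemma greedy_terminates e l T : 0 < l -> greedy_terminates_from e l T.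
Proof.
move=> l_gt0; have [k] := ubnP #|~: verts T|.
elim: k T => [T|k IHk T lt_k]; first by rewrite ltn0.
apply: Acc_intro => T' [v [S [vT Sout cardS defT']]].
refine (IHk T' _); rewrite -ltnS; apply: leq_trans lt_k; rewrite !ltnS defT'.
have := cardsC (verts T); have := cardsC (verts (adjoin T v S)).
rewrite (card_verts_adjoin Sout) cardS => <-.
by rewrite -addnA => /addnI ->; rewrite -[X in X < _]add0n ltn_add2r.
Qed.

(** * Halted trees span *)

Lemma min_degree_le e v : min_degree e <= degree e v.
Proof.
rewrite /min_degree; have: v \in index_enum V by apply: mem_index_enum.
elim: (index_enum V) => //= x s IHs.
rewrite inE big_cons => /predU1P[<-|/IHs]; first exact: geq_minl.
exact: leq_trans (geq_minr _ _).
Qed.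

Lemma card_edges_between e (A B : {set V}) : symmetric e ->
  \sum_(x in A) #|neighbors e x :&: B| = \sum_(y in B) #|neighbors e y :&: A|.
Proof.
have card_sum x (C : {set V}) :
    #|neighbors e x :&: C| = \sum_(y in C) e x y.
  rewrite -sum1_card big_mkcond [RHS]big_mkcond; apply: eq_bigr => y _.
  by rewrite !inE; case: (y \in C); case: (e x y).
move=> e_sym; under eq_bigr do rewrite card_sum.
rewrite exchange_big; apply: eq_bigr => y _; rewrite card_sum.
by apply: eq_bigr => x _; rewrite e_sym.
Qed.

Lemma neighbors_split e (A : {set V}) x :
  degree e x = #|neighbors e x :&: A| + #|neighbors e x :&: ~: A|.
Proof. by rewrite -setDE cardsID. Qed.

Lemma card_neighbors_in e (A : {set V}) x : irreflexive e -> x \in A ->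
  #|neighbors e x :&: A| < #|A|.
Proof.
move=> e_irr xA; apply: proper_card; apply/properP.
by split; [apply: subsetIr | exists x; rewrite // !inE e_irr].
Qed.

End Adjoining.

(** The final contradiction, with [a] and [m] for the numbers of vertices inside
    and outside the tree and [d] for the minimum degree.  The premises on the
    last line are the degree bound at a vertex of the tree, and the double count
    of the edges leaving the tree with [m * m] moved to the right to avoid
    truncated subtraction. *)
Lemma halted_arith l d a m :
    1 < l -> l <= m -> d < a + m -> (l - 1) * (a + m) < l * d ->
    d + 2 <= a + l -> m * (d + 1) <= (l - 1) * a + m * m -> False.
Proof.
case: l => [|[|k]] // _ le_lm /[dup] lt_dn /ltnW/subnKC.
set r := a + m - d => def_n deg_min deg_in count.
have r_gt0 : 0 < r by rewrite subn_gt0.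
rewrite subn1 /= in deg_min count.
have lt_rd : k.+1 * r < d by nia.
have [s def_m] : exists s, m = k.+2 + s by exists (m - k.+2); rewrite subnKC.
(* The double count, with [l = k.+2] and [m - l = s]. *)
have lt_sd : s * d < s * m by nia.
have lt_dm : d < m by move: lt_sd; rewrite ltn_mul2l => /andP[].
nia.
Qed.

Lemma halted_spanning (V : finType) (e : rel V) (l : nat) (T : subgraph V) :
    symmetric e -> irreflexive e -> 0 < l -> connected_graph e ->
    (l - 1) * #|V| < l * min_degree e ->
    0 < #|verts T| -> #|V| = #|verts T| %[mod l] -> greedy_halted e l T ->
  verts T = [set: V].
Proof.
move=> e_sym e_irr l_gt0 [_ e_conn] deg_min /card_gt0P[v vT] eq_mod halted.
have few x : x \in verts T -> #|neighbors e x :&: ~: verts T| < l.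
  move=> xT; rewrite -setDE ltnNge; apply/negP=> le_l.
  by case: halted; exists x.
apply/eqP; rewrite -subTset -[verts T]setCK -setC0 setCS subset0 -cards_eq0.
apply: contraT; rewrite -lt0n => m_gt0.
(* For [l = 1] the double count gives no contradiction; connectedness does. *)
have [l1|l_gt1] : l = 1 \/ 1 < l by lia.
  have clT : closed e (verts T).
    apply: (intro_closed (sym_connect_sym e_sym)) => x y exy xT.
    apply: contraT => yT; have := few x xT.
    by rewrite l1 ltnS leqn0 cards_eq0 => /eqP/setP/(_ y); rewrite !inE exy yT.
  case/card_gt0P: m_gt0 => w; rewrite inE.
  by rewrite -(closed_connect clT (e_conn v w)) vT.
have cardV := cardsC (verts T).
have le_lm : l <= #|~: verts T|.
  apply: dvdn_leq m_gt0 _; move/eqP: eq_mod.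
  by rewrite -cardV eqn_mod_dvd ?leq_addr // addKn.
have d_lt : min_degree e < #|V|.
  apply: leq_ltn_trans (min_degree_le e v) _.
  by rewrite /degree -cardsT -[neighbors e v]setIT card_neighbors_in // inE.
exfalso; apply: (halted_arith l_gt1 le_lm (d := min_degree e) (a := #|verts T|)).
- by rewrite cardV.
- by rewrite cardV.
- have := min_degree_le e v; rewrite (neighbors_split e (verts T)).
  have := card_neighbors_in e_irr vT; have := few v vT; lia.
have up : \sum_(x in verts T) #|neighbors e x :&: ~: verts T|
          <= (l - 1) * #|verts T|.
  rewrite mulnC -sum_nat_const; apply: leq_sum => x /few; lia.
(* An outer vertex is not its own neighbor, whence the [+ 1]. *)
have low : #|~: verts T| * (min_degree e + 1) <=
    \sum_(y in ~: verts T) (#|neighbors e y :&: verts T| + #|~: verts T|).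
  rewrite -sum_nat_const; apply: leq_sum => y yT.
  have := min_degree_le e y; rewrite (neighbors_split e (verts T)).
  have := card_neighbors_in e_irr yT; lia.
apply: leq_trans low _.
by rewrite big_split /= sum_nat_const leq_add2r -card_edges_between.
Qed.

Theorem proposition2p1 (V : finType) (e : rel V) (l : nat)
    (e_sym : symmetric e) (e_irr : irreflexive e)
    (l_gt0 : 0 < l)
    (e_conn : connected_graph e)
    (n_mod : #|V| = 2 %[mod l])
    (deg_min : ((l%:R - 1) * #|V|%:R / l%:R < (min_degree e)%:R :> rat)%R) :
  greedy_always_returns e l (congruent_spanning_tree e l).
Proof.
have {}deg_min : (l - 1) * #|V| < l * min_degree e.
  have predlE : (l%:R - 1 = (l - 1)%:R :> rat)%R by rewrite natrB.
  move: deg_min; rewrite predlE ltr_pdivrMr ?ltr0n //.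
  by rewrite -!natrM ltr_nat (mulnC l).
split.
- case: (e_conn) => /card_gt0P[x _] _.
  have /card_gt0P[y] : 0 < degree e x.
    by apply: leq_trans (min_degree_le e x); case: min_degree deg_min; rewrite ?muln0.
  by rewrite inE => exy; exists (edge_subgraph x y), x, y.
- by move=> T _; apply: greedy_terminates.
move=> T [/(reachable_invariant e_sym e_irr)[sub_eT treeT T_gt1 cardT degT] halted].
split=> //; last by split=> // x y xT yT; rewrite (degT x) ?(degT y).
by apply: (halted_spanning e_sym) halted; rewrite // ?(ltnW T_gt1) ?n_mod.
Qed.
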